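(* Let $X$ be a finite, nonempty set and $n = |X|$. Let $\mathcal{DP}_X / \approx$ denote the quotient set of $\mathcal{DP}_X$ defined by $\approx$. Then the cardinality $|\mathcal{DP}_X / \approx|$ equals the number of distinct representations of $n$ as a sum of positive integers (that is, the number of partitions of the integer $n$).
   Context: A pseudometric on $X$ is a function $d\colon X^2\to\mathbb{R}$ that is nonnegative, symmetric, satisfies $d(x,x)=0$ for all $x\in X$, and satisfies the triangle inequality. It is discrete if $|d(X^2)|\leqslant 2$. $\mathcal{DP}_X$ is the set of all discrete pseudometrics on $X$. For $d_1,d_2\in\mathcal{DP}_X$ write $d_1\approx d_2$ if $d_1$ is combinatorially similar to $d_2$, i.e. if there are bijections $g\colon X\to X$ and $f\colon d_1(X^2)\to d_2(X^2)$ such that $d_2(x,y)=f(d_1(g(x),g(y)))$ for all $x,y\in X$. The relation $\approx$ is an equivalence relation on $\mathcal{DP}_X$. A representation of a positive integer $n$ as a sum of positive integers (a partition of $n$) is a finite sequence $n_1\geqslant\ldots\geqslant n_k$ of positive integers with $n=\sum_{i=1}^k n_i$. *)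

(* Defs.v *)
From mathcomp Require Import all_boot all_order all_algebra.
From mathcomp Require Import boolp classical_sets functions cardinality reals.

Set Implicit Arguments.
Unset Strict Implicit.
Unset Printing Implicit Defensive.

Import Order.TTheory GRing.Theory Num.Theory.
Local Open Scope classical_set_scope.
Local Open Scope card_scope.
Local Open Scope ring_scope.

Definition pseudometric (R : realType) (X : Type) (d : X * X -> R) : Prop :=
  [/\ forall x y, 0 <= d (x, y),
      forall x y, d (x, y) = d (y, x),
      forall x, d (x, x) = 0
    & forall x y z, d (x, z) <= d (x, y) + d (y, z)].

Definition discrete_pseudometrics (R : realType) (X : Type)
    : set (X * X -> R) :=
  [set d | pseudometric d /\ range d #<= `I_2].
Arguments discrete_pseudometrics R X : clear implicits.

(* The bijection between the two sets of values is given by a total function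
   [f : R -> R] of which only the restriction to [range d1] matters. *)
Definition comb_similar (R : realType) (X : Type) (d1 d2 : X * X -> R) : Prop :=
  exists (g : X -> X) (f : R -> R),
    [/\ bijective g, set_bij (range d1) (range d2) f
      & forall x y, d2 (x, y) = f (d1 (g x, g y))].

(* Set of the classes of [A] modulo [r], for [r] an equivalence on [A]. *)
Definition quotient_set (T : Type) (A : set T) (r : T -> T -> Prop)
    : set (set T) :=
  [set [set y | A y /\ r x y] | x in A].

Definition int_partitions (n : nat) : set (seq nat) :=
  [set s | [/\ sorted geq s, all (leq 1) s & sumn s = n]].

(* Main.v *)
Require Import Defs.
From mathcomp Require Import all_boot all_order all_algebra.
From mathcomp Require Import boolp classical_sets functions cardinality reals.
From mathcomp Require Import perm.

(** Since a pseudometric vanishes on the diagonal, a discrete one takes at most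
    one nonzero value, so up to combinatorial similarity it is the equivalence
    relation [d (x, y) = 0] up to a permutation of [X]. Such a relation is the
    kernel of a colouring of [X] by natural numbers; ordering the colours by
    decreasing class size gives a partition [s] of [#|X|]. This [s] is
    determined by the relation because [k] times the multiplicity of [k] in [s]
    is the number of points whose class has [k] elements. *)

Set Implicit Arguments.
Unset Strict Implicit.
Unset Printing Implicit Defensive.

Import Order.TTheory GRing.Theory Num.Theory.
Local Open Scope classical_set_scope.

Section Colourings.
Variable X : finType.
Implicit Types (c : X -> nat) (s t : seq nat) (i k : nat).

(* Colour [i] is used [nth 0 s i] times, hence never for [i >= size s]. *)
Definition colouring_profile c s :=
  forall i, #|[pred x | c x == i]| = nth 0 s i.

Lemma ltn_colouring c s x : colouring_profile c s -> c x < size s.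
Proof.
move=> cs; rewrite ltnNge; apply/negP => le_sz.
have := cs (c x); rewrite (nth_default _ le_sz) => /card0_eq/(_ x).
by rewrite !inE eqxx.
Qed.

Lemma sum_colouring c s (F : nat -> nat) : colouring_profile c s ->
  \sum_(x : X) F (c x) = \sum_(i < size s) nth 0 s i * F i.
Proof.
move=> cs.
rewrite (partition_big (fun x => Ordinal (ltn_colouring x cs)) xpredT) //=.
apply: eq_bigr => i _; rewrite -cs -sum_nat_const; apply: eq_big => [x|x].
  by rewrite inE -val_eqE.
by move=> /eqP <-.
Qed.

Lemma sumn_colouring c s : colouring_profile c s -> sumn s = #|X|.
Proof.
move=> cs; rewrite -sum1_card (sum_colouring (fun=> 1) cs) sumnE.
by rewrite (big_nth 0) big_mkord; apply: eq_bigr => i _; rewrite muln1.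
Qed.

(** The class of [x] has size [nth 0 s (c x)], so each colour [i] with [nth 0 s i = k] accounts for
    exactly [k] points. The left side depends only on the kernel of [c], which makes multiplicities
    in [s] invariants of that kernel. *)
Lemma card_class_colouring c s k : colouring_profile c s ->
  #|[pred x | #|[pred y | c y == c x]| == k]| = k * count_mem k s.
Proof.
move=> cs; rewrite -sum1_card big_mkcond /=.
rewrite (eq_bigr (fun x => (nth 0 s (c x) == k) : nat)); last first.
  by move=> x _; rewrite inE cs; case: (_ == k).
rewrite (sum_colouring (fun i => nth 0 s i == k) cs).
rewrite -sum1_count (big_nth 0) big_mkord big_distrr /= [RHS]big_mkcond /=.
by apply: eq_bigr => i _; case: eqP => [->|]; rewrite ?muln0.
Qed.

Lemma colouring_profile_uniq c c' s t :
  (forall x y, (c x == c y) = (c' x == c' y)) ->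
  colouring_profile c s -> colouring_profile c' t ->
  sorted geq s -> all (leq 1) s -> sorted geq t -> all (leq 1) t -> s = t.
Proof.
move=> cc' cs c't ss s0 st t0.
apply: (@sorted_eq _ geq) => //.
- by move=> x y z /= yx zy; apply: leq_trans zy yx.
- by move=> x y /= /andP[yx xy]; apply/eqP; rewrite eqn_leq xy.
apply/allP => k _; apply/eqP.
(* For a positive value the factor [k] cancels in the class count. For 0 that count is vacuous, and
   positivity of the entries is used instead. *)
case: k => [|k]; last first.
  apply/eqP; rewrite -(eqn_pmul2l (ltn0Sn k)).
  rewrite -(card_class_colouring _ cs) -(card_class_colouring _ c't).
  apply/eqP; apply: eq_card => x; rewrite !inE; congr (_ == _).
  by apply: eq_card => y; rewrite !inE cc'.
have no0 u : all (leq 1) u -> count_mem 0 u = 0.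
  by move=> u0; apply/count_memPn/negP => /(allP u0).
by rewrite !no0.
Qed.

Lemma count_mem_codom c i : count_mem i (codom c) = #|[pred x | c x == i]|.
Proof.
by rewrite count_map -size_filter cardE; congr size; rewrite enumT /enum_mem.
Qed.

(** The lists of colours of [c] and [c'] along the enumeration of [X] have equal multiplicities,
    hence differ by a permutation of positions, which is transported to [X] through [enum_rank] and
    [enum_val]. *)
Lemma colouring_bij c c' s : colouring_profile c s -> colouring_profile c' s ->
  exists2 g : X -> X, bijective g & forall x, c' x = c (g x).
Proof.
move=> cs c's.
have /tuple_permP[p pE] : perm_eq (codom_tuple c') (codom_tuple c).
  by apply/allP => i _; rewrite /= !count_mem_codom cs c's.
exists (fun x => enum_val (p (enum_rank x))).
  exists (fun x => enum_val ((p^-1)%g (enum_rank x))) => x.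
    by rewrite enum_valK permK enum_rankK.
  by rewrite enum_valK permKV enum_rankK.
have {}pE := val_inj pE.
move=> x; have := congr1 (fun u => tnth u (enum_rank x)) pE.
by rewrite tnth_mktuple !tnth_map /tnth -!enum_val_nth enum_rankK.
Qed.

Lemma colouring_exists s : sumn s = #|X| -> exists c, colouring_profile c s.
Proof.
(* The word [w] contains each [j] exactly [nth 0 s j] times and has length [#|X|]; a point is
   coloured by the letter at its rank. *)
move=> sX; pose w := flatten [seq nseq (nth 0 s j) j | j <- iota 0 (size s)].
have szw : size w = #|X|.
  rewrite size_flatten /shape -map_comp -sX; congr sumn.
  rewrite -[RHS](mkseq_nth 0); apply: eq_map => j /=.
  by rewrite size_nseq.
exists (fun x => nth 0 w (enum_rank x)) => i.
rewrite -count_mem_codom.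
have -> : codom (fun x : X => nth 0 w (enum_rank x)) = w.
  apply: (@eq_from_nth _ 0); rewrite size_codom // => j ltj.
  by rewrite (nth_codom _ _ (Ordinal ltj)) enum_valK.
rewrite count_flatten -map_comp sumnE big_map.
rewrite (eq_bigr (fun j => if j == i then nth 0 s j else 0)); last first.
  by move=> j _; rewrite /= count_nseq /=; case: eqP; rewrite ?mul1n ?mul0n.
have [lti|lei] := ltnP i (size s).
  rewrite (bigD1_seq i) ?iota_uniq ?mem_iota //= eqxx big1 ?addn0 // => j.
  by move/negbTE->.
rewrite nth_default // big_seq big1 // => j; rewrite mem_iota add0n.
by case: eqP => // ->; rewrite ltnNge lei.
Qed.

Lemma equivalence_colouring (e : rel X) : equivalence_rel e ->
  exists c s, [/\ forall x y, (c x == c y) = e x y, colouring_profile c s,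
    sorted geq s & all (leq 1) s].
Proof.
move=> eqe; pose cl x : {set X} := [set y | e x y]%SET.
have cl_e x y : (cl x == cl y) = e x y.
  apply/eqP/idP => [/setP/(_ y)|exy].
    by rewrite !inE (eqe y y y).1 => ->.
  by apply/setP => z; rewrite !inE; apply: (eqe x y z).2.
(* The distinct classes are listed by decreasing cardinality. The colour of a point is the index of
   its class, and the profile is the list of cardinalities. *)
pose ge_card := relpre (fun A : {set X} => #|A|) geq.
pose bs := sort ge_card (undup (codom cl)).
have mem_bs x : cl x \in bs by rewrite mem_sort mem_undup codom_f.
have bs_uniq : uniq bs by rewrite sort_uniq undup_uniq.
have bsP A : A \in bs -> exists x, A = cl x.
  by rewrite mem_sort mem_undup => /codomP.
exists (fun x => index (cl x) bs), [seq #|A| | A : {set X} <- bs]; split.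
- move=> x y; rewrite -cl_e; apply/eqP/eqP => [|->] //.
  by move=> exy; rewrite -(nth_index (cl y) (mem_bs x)) exy nth_index.
- move=> i; have [lti|lei] := ltnP i (size bs); last first.
    rewrite nth_default ?size_map //; apply: eq_card0 => x; rewrite !inE.
    by apply/eqP => xi; move: lei; rewrite -xi leqNgt index_mem mem_bs.
  rewrite (nth_map finset.set0) //.
  have [z zE] := bsP _ (mem_nth finset.set0 lti).
  rewrite zE; apply: eq_card => x; rewrite !inE -cl_e -zE [RHS]eq_sym.
  apply/eqP/eqP => [<-|->]; first by rewrite nth_index.
  by rewrite index_uniq.
- by rewrite sorted_map; apply: sort_sorted => A B; apply: leq_total.
- apply/allP => _ /mapP[A /bsP[x ->] ->]; apply/card_gt0P; exists x.
  by rewrite inE (eqe x x x).1.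
Qed.

End Colourings.

(** [P] is a complete invariant given as a relation, so that no value has to be chosen for each [x].
    Sending [u] to the set of points of [A] with invariant [u] maps [B] onto the quotient,
    injectively since invariants are unique. *)
Lemma card_quotient_set (T U : Type) (A : set T) (B : set U)
    (r : T -> T -> Prop) (P : T -> U -> Prop) :
  (forall x, A x -> exists2 u, B u & P x u) ->
  (forall u, B u -> exists2 x, A x & P x u) ->
  (forall x u v, A x -> B u -> B v -> P x u -> P x v -> u = v) ->
  (forall x y u, A x -> A y -> B u -> P x u -> (r x y <-> P y u)) ->
  (quotient_set A r #= B)%card.
Proof.
move=> AB BA Puniq Pr.
pose f u := [set x | A x /\ P x u].
have fE x u : A x -> B u -> P x u -> [set y | A y /\ r x y] = f u.
  move=> Ax Bu Pxu; apply/seteqP; split => y [Ay].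
    by move/(Pr x y u) => h; split => //; exact: h.
  by move=> Pyu; split => //; apply/(Pr x y u).
have -> : quotient_set A r = f @` B.
  apply/seteqP; split => [_ [x Ax <-]|_ [u Bu <-]].
    by have [u Bu Pxu] := AB x Ax; exists u => //; rewrite (fE x u).
  by have [x Ax Pxu] := BA u Bu; exists x => //; rewrite (fE x u).
apply: inj_card_eq => u v /set_mem Bu /set_mem Bv fuv.
have [x Ax Pxu] := BA u Bu.
have [_ Pxv] : f v x by rewrite -fuv.
exact: Puniq Pxu Pxv.
Qed.

Local Open Scope ring_scope.

Section DiscretePseudometrics.
Variables (R : realType) (X : finType).
Implicit Type d : X * X -> R.

Lemma pseudometric_equivalence d : pseudometric d ->
  equivalence_rel (fun x y => d (x, y) == 0).
Proof.
move=> [d0 dC dxx dT] x y z; split; first by rewrite dxx.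
move=> /eqP dxy; congr (_ == 0); apply: le_anti.
(* Points at distance 0 are equally far from any [z], by two triangle inequalities. *)
have := dT x y z; have := dT y x z.
by rewrite (dC y x) dxy !add0r => -> ->.
Qed.

Lemma discrete_pseudometric_eq d p q : discrete_pseudometrics R X d ->
  d p != 0 -> d q != 0 -> d p = d q.
Proof.
move=> [[_ _ dxx _] /pcard_leP/unsquash f] dp dq.
have rd u : d u \in range d by apply/mem_set; exists u.
have f_lt u : (f (d u) < 2)%N by have /= := 'funS_f (set_mem (rd u)).
have f_inj u v : f (d u) = f (d v) -> d u = d v.
  by apply: ('inj_f); apply: rd.
(* [f] codes the values of [d] by 0 and 1. The value 0, attained at [(p.1, p.1)], takes one code, so
   [d p] and [d q] share the other. *)
apply: (f_inj); move: (f_lt p) (f_lt q) (f_lt (p.1, p.1)).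
have : f (d p) != f (d (p.1, p.1)).
  by apply: contra_neq dp => /f_inj ->.
have : f (d q) != f (d (p.1, p.1)).
  by apply: contra_neq dq => /f_inj ->.
by case: (f (d p)) (f (d q)) (f (d (p.1, p.1))) => [|[|a]] [|[|b]] [|[|c]].
Qed.

Lemma comb_similarP d1 d2 :
  discrete_pseudometrics R X d1 -> discrete_pseudometrics R X d2 ->
  comb_similar d1 d2 <->
  exists2 g : X -> X, bijective g &
    forall x y, (d2 (x, y) == 0) = (d1 (g x, g y) == 0).
Proof.
move=> D1 D2; split => [[g [f [gbij [_ finj _] d2E]]]|[g gbij d2E]].
  have [[_ _ d1xx _] _] := D1; have [[_ _ d2xx _] _] := D2.
  exists g => // x y.
  (* Both functions vanish on the diagonal, so [f] fixes 0, and by injectivity it sends no other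
     value of [d1] to 0. *)
  have f0 : f (d1 (g x, g x)) = 0 by rewrite -d2E.
  rewrite d2E; apply/eqP/eqP => [fxy|->]; last by rewrite -(d1xx (g x)) f0.
  rewrite -(d1xx (g x)); apply: finj; rewrite ?f0 //.
    by apply/mem_set; exists (g x, g y).
  by apply/mem_set; exists (g x, g x).
(* [c] is the only nonzero value of [d2]. If there is none, [d1] vanishes too, and the default is
   never reached on [range d1]. *)
pose c := if [pick p | d2 p != 0] is Some p then d2 p else 0.
pose f (r : R) := if r == 0 then 0 else c.
have fE x y : d2 (x, y) = f (d1 (g x, g y)).
  rewrite /f -d2E; case: eqP => // /eqP nz; rewrite /c.
  case: pickP => [q nzq|/(_ (x, y))]; last by rewrite nz.
  exact: discrete_pseudometric_eq.
have [h gh hg] := gbij.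
have d1E x y : (d1 (x, y) == 0) = (d2 (h x, h y) == 0) by rewrite d2E !hg.
have fhE x y : f (d1 (x, y)) = d2 (h x, h y) by rewrite fE !hg.
exists g, f; split => //; split.
- by move=> _ [[x y] _ <-]; exists (h x, h y); rewrite ?fhE.
- move=> _ _ /set_mem[[x y] _ <-] /set_mem[[z t] _ <-]; rewrite !fhE => e.
  have : (d1 (x, y) == 0) = (d1 (z, t) == 0).
    by rewrite !d1E e.
  case: eqP => [-> /esym/eqP -> //|/eqP nz /esym/negbT nz'].
  exact: discrete_pseudometric_eq.
- by move=> _ [[x y] _ <-]; exists (d1 (g x, g y)); rewrite -?fE.
Qed.

Lemma discrete_pseudometric_colouring (T : eqType) (c : X -> T) :
  discrete_pseudometrics R X (fun p => (c p.1 != c p.2)%:R).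
Proof.
split; first split => /=.
- by move=> x y; exact: ler0n.
- by move=> x y; rewrite eq_sym.
- by move=> x; rewrite eqxx.
- move=> x y z; rewrite -natrD ler_nat.
  by case: (eqVneq (c x) (c y)) => [->|_]; [rewrite add0n|case: (_ != c z)].
(* All values are images of the naturals 0 and 1. *)
apply: (@card_le_trans _ _ _ ((fun n => n%:R : R) @` `I_2)).
  apply: subset_card_le => _ [p _ <-]; exists (c p.1 != c p.2) => //=.
  by case: (_ != _).
exact: card_image_le.
Qed.

End DiscretePseudometrics.

Theorem proposition3p10 (R : realType) (X : finType) (hX : (0 < #|X|)%N) :
  (quotient_set (discrete_pseudometrics R X) (@comb_similar R X)
     #= int_partitions #|X|)%card.
Proof.
pose kernel_colouring (d : X * X -> R) (c : X -> nat) :=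
  forall x y, (c x == c y) = (d (x, y) == 0).
(* The invariant of [d] is the profile of a colouring whose classes are those of the relation
   [d (x, y) = 0]. *)
apply: (@card_quotient_set _ _ _ _ _
  (fun d s => exists2 c, kernel_colouring d c & colouring_profile c s)).
- move=> d [/pseudometric_equivalence/equivalence_colouring] dE _.
  have [c [s [dc cs ss s0]]] := dE.
  by exists s; [split; rewrite ?(sumn_colouring cs)|exists c].
- move=> s [_ _ /colouring_exists[c cs]].
  exists (fun p => (c p.1 != c p.2)%:R).
    exact: discrete_pseudometric_colouring.
  by exists c => // x y /=; case: (_ == _); rewrite ?eqxx ?oner_eq0.
- move=> d s t _ [ss s0 _] [st t0 _] [c dc cs] [c' dc' c't].
  by apply: (colouring_profile_uniq _ cs c't) => // x y; rewrite dc dc'.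
- move=> d1 d2 s D1 D2 _ [c dc cs].
  apply: (iff_trans (comb_similarP D1 D2)).
  split => [[g gbij d2E]|[c' dc' c's]].
    (* Composing with a bijection preserves the size of every colour class, hence the profile. *)
    exists (c \o g) => [x y|i]; first by rewrite /= dc d2E.
    have [h _ hg] := gbij.
    rewrite -cs.
    apply: etrans (card_preim (bij_inj gbij) [pred x | c x == i]) _.
    by apply: eq_card => x; rewrite !inE -[x]hg codom_f.
  have [g gbij c'E] := colouring_bij cs c's.
  by exists g => // x y; rewrite -dc' -dc !c'E.
Qed.
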